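(* For each positive integer $n$ with $n \equiv 0$ or $3 \pmod 4$, let $S(n)$ be the coefficient of $x^{n(n+1)/4}$ in the expansion of the polynomial $(1+x)(1+x^2)\cdots(1+x^n)$. Then $S(n) \sim \sqrt{6/\pi}\cdot 2^n n^{-3/2}$ as $n \to \infty$ through the positive integers congruent to $0$ or $3$ modulo $4$; that is, $$\lim_{\substack{n\to\infty\\ n\equiv 0,3 \,(\mathrm{mod}\ 4)}} \frac{S(n)}{\sqrt{6/\pi}\cdot 2^n n^{-3/2}} = 1.$$
   Context: When $n \equiv 0$ or $3 \pmod 4$, the number $n(n+1)/4$ is an integer, so $S(n)$ is the middle coefficient of the polynomial. The notation $f(n)\sim g(n)$ means $\lim_{n\to\infty} f(n)/g(n) = 1$. *)

(* Defs.v *)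
From mathcomp Require Import all_boot all_order all_algebra.
From mathcomp Require Import all_classical all_reals all_analysis.

Set Implicit Arguments.
Unset Strict Implicit.
Unset Printing Implicit Defensive.

Import Order.TTheory GRing.Theory Num.Theory.
Import numFieldNormedType.Exports.

Local Open Scope ring_scope.

Definition prod_1Xk (n : nat) : {poly int} :=
  \prod_(1 <= k < n.+1) (1 + 'X^k).

Definition admissible (n : nat) : Prop :=
  (0 < n)%N /\ (n = 0 %[mod 4] \/ n = 3 %[mod 4]).

(* n * n.+1 is divisible by 4 whenever n is admissible; the truncated quotient
   at other n is immaterial. *)
Definition mid_coef (n : nat) : int := (prod_1Xk n)`_((n * n.+1) %/ 4)%N.

(* Main.v *)
Require Import Defs.
From mathcomp Require Import all_boot all_order all_algebra.
From mathcomp Require Import all_classical all_reals all_analysis.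
From mathcomp Require Import measurable_realfun.
From mathcomp Require Import ring lra zify.

(* Writing N = n(n+1)/2, one has 2^n \prod_(k <= n) cos(k t) =
   \sum_j p_j cos((2j - N) t), where p_j are the coefficients of the
   polynomial.  For admissible n all the frequencies 2j - N are even, so that
   integrating over [0, pi/2] isolates the middle coefficient S(n).  After the
   rescaling t = s v with s = sqrt 6 * n^(-3/2) the integrand converges
   pointwise to exp(-v^2), because \sum_k k^2 ~ n^3/3, and it is dominated by a
   multiple of 1/(1 + v^2): if t <= 2/n, by sin x >= x/3 on [0, 2]; if t >= 2/n,
   by |cos x| <= exp(-(sin x)^2/2) and \sum_k (sin k t)^2 >= n/8.  Dominated
   convergence and the Gaussian integral conclude. *)

Set Implicit Arguments.
Unset Strict Implicit.
Unset Printing Implicit Defensive.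

Import Order.TTheory GRing.Theory Num.Theory.
Import numFieldNormedType.Exports.

Local Open Scope classical_set_scope.
Local Open Scope ring_scope.

(** * Taylor and exponential bounds for sine and cosine *)

Lemma derive_ge0_ge0 (R : realType) (f df : R -> R) :
  (forall x : R, is_derive x 1 f (df x)) -> f 0 = 0 ->
  (forall x, 0 <= x -> 0 <= df x) -> forall x, 0 <= x -> 0 <= f x.
Proof.
move=> fdf f0 df0 x x0.
have cf : {within `[0, x], continuous f}.
  by apply: derivable_within_continuous => y _; apply: ex_derive.
have [c] := MVT_segment x0 (fun y _ => fdf y) cf.
rewrite in_itv/= f0 !subr0 => /andP[c0 _] ->.
by rewrite mulr_ge0// df0.
Qed.

(** Start of a chain: in the next two bounds, the derivative of the difference of the two sides is
    the difference from the bound before. *)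
Lemma sin_le_id (R : realType) (x : R) : 0 <= x -> sin x <= x.
Proof.
move=> x0; rewrite -subr_ge0.
apply: (@derive_ge0_ge0 R (fun x => x - sin x) (fun x => 1 - cos x)) => //.
- by rewrite sin0 subr0.
Qed.

Lemma cos_ge (R : realType) (x : R) : 0 <= x -> 1 - x ^+ 2 / 2 <= cos x.
Proof.
move=> x0; rewrite -subr_ge0.
apply: (@derive_ge0_ge0 R (fun x => cos x - (1 - x ^+ 2 / 2))
  (fun x => x - sin x)) => //.
- move=> y; apply: is_derive_eq.
  rewrite /GRing.scale /=; lra.
- by rewrite cos0 expr0n /= mul0r subr0 subrr.
- by move=> y y0; rewrite subr_ge0 sin_le_id.
Qed.

Lemma sin_ge (R : realType) (x : R) : 0 <= x -> x - x ^+ 3 / 6 <= sin x.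
Proof.
move=> x0; rewrite -subr_ge0.
apply: (@derive_ge0_ge0 R (fun x => sin x - (x - x ^+ 3 / 6))
  (fun x => cos x - (1 - x ^+ 2 / 2))) => //.
- move=> y; apply: is_derive_eq.
  rewrite /GRing.scale /=; lra.
- by rewrite sin0 expr0n /= mul0r !subr0.
- by move=> y y0; rewrite subr_ge0 cos_ge.
Qed.

Lemma sin_ge_third (R : realType) (x : R) : 0 <= x <= 2 -> x / 3 <= sin x.
Proof.
move=> /andP[x0 x2]; apply: le_trans (sin_ge x0).
have : x ^+ 2 <= 2 ^+ 2 by rewrite ler_sqr ?nnegrE.
nra.
Qed.

(** Square root of cos^2 = 1 - sin^2 <= exp(- sin^2). *)
Lemma norm_cos_le_expR (R : realType) (x : R) :
  `|cos x| <= expR (- (sin x ^+ 2 / 2)).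
Proof.
rewrite -ler_sqr ?nnegrE ?expR_ge0//.
rewrite real_normK ?num_real// cos2sin2 [leRHS]expr2 -expRD.
apply: le_trans (expR_ge1Dx _).
lra.
Qed.

(** From [norm_cos_le_expR] and sin x >= x - x^3/6, whose square is at least x^2 - x^4/3; the
    coefficient 1/2 of x^4 leaves room. *)
Lemma cos_le_expR (R : realType) (x : R) : 0 <= x <= 1 ->
  cos x <= expR (- (x ^+ 2 / 2) + x ^+ 4 / 2).
Proof.
move=> /andP[x0 x1].
apply: le_trans (ler_norm _) _; apply: le_trans (norm_cos_le_expR x) _.
rewrite ler_expR.
have x2 : x ^+ 2 <= 1 by rewrite expr_le1.
have x3 : 0 <= x - x ^+ 3 / 6 by have := sqr_ge0 x; nra.
have : (x - x ^+ 3 / 6) ^+ 2 <= sin x ^+ 2.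
  by rewrite ler_sqr ?nnegrE ?sin_ge// (le_trans x3)// sin_ge.
have := sqr_ge0 (x^+2); have := sqr_ge0 (x ^+ 3).
lra.
Qed.

Lemma expR_le_cos (R : realType) (x : R) : 0 <= x <= 1 ->
  expR (- (x ^+ 2 / 2) - x ^+ 4 / 2) <= cos x.
Proof.
move=> /andP[x0 x1]; apply: le_trans (cos_ge x0).
have x2 : x ^+ 2 <= 1 by rewrite expr_le1.
have x20 := sqr_ge0 x.
rewrite -opprD expRN -[leRHS]invrK lef_pV2 ?posrE ?expR_gt0 ?invr_gt0//; last lra.
apply: le_trans (expR_ge1Dx _).
rewrite -[leLHS]mul1r ler_pdivrMr; last lra.
(* With u = x^2/2 + x^4/2, (1 + u)(1 - x^2/2) = 1 + x^4 (1 - x^2)/4. *)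
have : 0 <= x ^+ 4 * (1 - x ^+ 2) by rewrite mulr_ge0// ?subr_ge0// exprn_ge0.
lra.
Qed.

(** * Power sums and bounds on the cosine product *)

Lemma sum_sqr (R : realType) n :
  \sum_(1 <= k < n.+1) k%:R ^+ 2 = (n * n.+1 * n.*2.+1)%:R / 6 :> R.
Proof.
elim: n => [|n IH]; first by rewrite big_geq//= !mul0n mul0r.
rewrite big_nat_recr//= IH -!muln2 !natrM -![_.+1%:R]natr1 !natrM -!natr1; by field.
Qed.

Lemma sum_pow4_le (R : realType) n :
  \sum_(1 <= k < n.+1) k%:R ^+ 4 <= n%:R ^+ 5 :> R.
Proof.
elim: n => [|n IH]; first by rewrite big_geq//= expr0n.
rewrite big_nat_recr//=.
apply: (@le_trans _ _ (n%:R ^+ 5 + n.+1%:R ^+ 4)); first by rewrite lerD2r.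
rewrite -natr1; have : 0 <= n%:R :> R by [].
move: (n%:R : R) => x x0.
have := exprn_ge0 4 x0; have := exprn_ge0 3 x0; have := exprn_ge0 2 x0; lra.
Qed.

(* The Dirichlet kernel, without the division by sin t. *)
Lemma sin_mul_sum_cos (R : realType) n (t : R) :
  2 * sin t * \sum_(1 <= k < n.+1) cos (2 * k%:R * t) =
  sin ((2 * n%:R + 1) * t) - sin t.
Proof.
elim: n => [|n IH].
  by rewrite big_geq// mulr0 mulr0 add0r mul1r subrr.
rewrite big_nat_recr//= mulrDr IH.
have -> : (2 * n.+1%:R + 1) * t = 2 * n.+1%:R * t + t by lra.
have -> : (2 * n%:R + 1) * t = 2 * n.+1%:R * t - t by rewrite -natr1; lra.
rewrite sinB sinD; lra.
Qed.

Lemma prod_cos_le_expR (R : realType) n (t : R) :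
  `|\prod_(1 <= k < n.+1) cos (k%:R * t)| <=
  expR (- (\sum_(1 <= k < n.+1) sin (k%:R * t) ^+ 2) / 2).
Proof.
rewrite normr_prod mulNr mulr_suml -sumrN expR_sum.
by apply: ler_prod => k _; rewrite normr_ge0 norm_cos_le_expR.
Qed.

(** All angles k t lie in [0, 2], where sin x >= x/3, and the squares sum to at least n^3/3; hence
    54 = 2 * 9 * 3. *)
Lemma prod_cos_near (R : realType) n (t : R) : (0 < n)%N ->
  0 <= t <= 2 / n%:R ->
  `|\prod_(1 <= k < n.+1) cos (k%:R * t)| <= expR (- (t ^+ 2 * n%:R ^+ 3) / 54).
Proof.
move=> n0 /andP[t0 tn]; apply: le_trans (prod_cos_le_expR _ _) _.
rewrite ler_expR.
have s3 : (t / 3) ^+ 2 * \sum_(1 <= k < n.+1) k%:R ^+ 2 <=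
    \sum_(1 <= k < n.+1) sin (k%:R * t) ^+ 2.
  rewrite mulr_sumr; apply: ler_sum_nat => k /andP[k1 kn].
  rewrite -exprMn.
  have kt : 0 <= k%:R * t <= 2.
    rewrite mulr_ge0//=; rewrite ler_pdivlMr ?ltr0n// in tn.
    by apply: le_trans tn; rewrite mulrC ler_wpM2l// ler_nat.
  rewrite mulrC mulrA.
  have h := sin_ge_third kt.
  have kt0 : 0 <= k%:R * t / 3 by rewrite !mulr_ge0.
  by rewrite ler_sqr ?nnegrE// (le_trans kt0).
have : n%:R ^+ 3 / 3 <= \sum_(1 <= k < n.+1) k%:R ^+ 2 :> R.
  rewrite sum_sqr -muln2 !natrM -[n.+1%:R]natr1 -[(n * 2).+1%:R]natr1 natrM.
  have : 0 <= n%:R :> R by [].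
  have := sqr_ge0 (n%:R : R).
lra.
move/(ler_wpM2l (sqr_ge0 (t / 3))) => s2.
have := le_trans s2 s3; lra.
Qed.

Lemma prod_cos_far (R : realType) n (t : R) : (0 < n)%N ->
  2 / n%:R <= t <= 2 ->
  `|\prod_(1 <= k < n.+1) cos (k%:R * t)| <= expR (- n%:R / 16).
Proof.
move=> n0 /andP[tn t2]; apply: le_trans (prod_cos_le_expR _ _) _.
rewrite ler_expR.
have n0' : 0 < n%:R :> R by rewrite ltr0n.
have t0 : 0 < t by apply: lt_le_trans tn; rewrite divr_gt0.
have -> : \sum_(1 <= k < n.+1) sin (k%:R * t) ^+ 2 =
   n%:R / 2 - (\sum_(1 <= k < n.+1) cos (2 * k%:R * t)) / 2.
  have -> : n%:R = \sum_(1 <= k < n.+1) (1 : R).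
    by rewrite sumr_const_nat subn1.
  rewrite -mulrBl -sumrB mulr_suml; apply: eq_bigr => k _.
  suff -> : cos (2 * k%:R * t) = 1 - 2 * sin (k%:R * t) ^+ 2 by lra.
  rewrite -mulrA [2 * _]mulr_natl cos_mulr2n cos2sin2; lra.
have ts : t / 3 <= sin t by apply: sin_ge_third; rewrite (ltW t0).
have := sin_mul_sum_cos n t; have := sin_le1 ((2 * n%:R + 1) * t).
set C := \sum_(_ <= _ < _) _ => s1 sC.
(* The Dirichlet kernel gives C <= 1/(2 sin t) <= 3/(2t) <= 3n/4, which leaves n/2 - C/2 >= n/8. *)
suff : C <= 3 * n%:R / 4 by lra.
have s0 : 0 < sin t by apply: lt_le_trans ts; rewrite divr_gt0.
have : 2 * sin t * C <= 1 by lra.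
rewrite ler_pdivrMr// in tn.
rewrite -subr_ge0 => h.
rewrite -subr_ge0 -(pmulr_rge0 _ (mulr_gt0 (ltr0n R 2 : 0 < 2) s0)).
nra.
Qed.

(** Multiplies the bounds on each cosine, all angles being in [0, 1]. The term t^2 n^2/3 absorbs the
    lower-order part n^2/2 + n/6 of the sum of squares; in the upper bound this part has a
    favourable sign and is dropped. *)
Lemma prod_cos_bounds (R : realType) n (t : R) : 0 <= t -> n%:R * t <= 1 ->
  expR (- (t ^+ 2 * n%:R ^+ 3 / 6)
        - (t ^+ 2 * n%:R ^+ 2 / 3 + t ^+ 4 * n%:R ^+ 5 / 2)) <=
    \prod_(1 <= k < n.+1) cos (k%:R * t) <=
  expR (- (t ^+ 2 * n%:R ^+ 3 / 6) + t ^+ 4 * n%:R ^+ 5 / 2).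
Proof.
move=> t0 nt.
have kt k : (1 <= k < n.+1)%N -> 0 <= k%:R * t <= 1.
  move=> /andP[_ kn]; rewrite mulr_ge0//=; apply: le_trans nt.
  by rewrite ler_wpM2r// ler_nat.
have S2 := sum_sqr R n; have S4 := sum_pow4_le R n.
have {}S2 : \sum_(1 <= k < n.+1) k%:R ^+ 2 =
    n%:R ^+ 3 / 3 + n%:R ^+ 2 / 2 + n%:R / 6 :> R.
  rewrite S2 -muln2 !natrM -[n.+1%:R]natr1 -[(n * 2).+1%:R]natr1 natrM; lra.
have nn : n%:R <= n%:R ^+ 2 :> R by rewrite -natrX ler_nat; case: (n) => // m; nia.
have t2 := sqr_ge0 t.
have t4 : 0 <= t ^+ 4 by rewrite exprn_ge0.
apply/andP; split.
- apply: (@le_trans _ _ (\prod_(1 <= k < n.+1)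
      expR (- ((k%:R * t) ^+ 2 / 2) - (k%:R * t) ^+ 4 / 2))).
    rewrite -expR_sum ler_expR sumrB sumrN -!mulr_suml.
    under eq_bigr do rewrite exprMn.
    under [X in _ - X / _]eq_bigr do rewrite exprMn.
    rewrite -!mulr_suml S2; set s4 := \sum_(_ <= _ < _) _ in S4 *.
    have := ler_wpM2r t4 S4; have := ler_wpM2l t2 nn.
    lra.
  rewrite !big_seq; apply: ler_prod => k; rewrite mem_index_iota => /kt kt1.
  by rewrite expR_ge0 expR_le_cos.
- apply: (@le_trans _ _ (\prod_(1 <= k < n.+1)
      expR (- ((k%:R * t) ^+ 2 / 2) + (k%:R * t) ^+ 4 / 2))).
    rewrite !big_seq; apply: ler_prod => k; rewrite mem_index_iota => /kt kt1.
    rewrite cos_le_expR// andbT (le_trans _ (expR_le_cos kt1))//.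
  rewrite -expR_sum ler_expR big_split/= sumrN -!mulr_suml.
  under eq_bigr do rewrite exprMn.
  under [X in _ + X / _]eq_bigr do rewrite exprMn.
  rewrite -!mulr_suml S2; set s4 := \sum_(_ <= _ < _) _ in S4 *.
  have := ler_wpM2r t4 S4.
  have : 0 <= t ^+ 2 * (n%:R ^+ 2 / 2 + n%:R / 6) by rewrite mulr_ge0// addr_ge0.
  lra.
Qed.

(* 10^5 is a round upper bound for the constants 9 and 12 * 16^3 of the two
   regimes. *)
Lemma prod_cos_dominated (R : realType) n (s v : R) : (0 < n)%N ->
  0 <= s -> s ^+ 2 * n%:R ^+ 3 = 6 -> 0 <= v -> s * v <= 2 ->
  `|\prod_(1 <= k < n.+1) cos (k%:R * (s * v))| <= 10 ^+ 5 / (1 + v ^+ 2).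
Proof.
move=> n0 s0 sn v0 sv2.
have n1 : 1 <= n%:R :> R by rewrite ler1n.
have sv0 : 0 <= s * v by rewrite mulr_ge0.
have v2 := sqr_ge0 v.
have tn : (s * v) ^+ 2 * n%:R ^+ 3 = 6 * v ^+ 2 by rewrite -sn; ring.
have [near0|far] := leP (s * v) (2 / n%:R).
- have t0 : 0 <= s * v <= 2 / n%:R by rewrite sv0.
  apply: le_trans (prod_cos_near n0 t0) _.
  rewrite tn mulNr expRN -[leRHS]invf_div lef_pV2 ?posrE ?expR_gt0 ?divr_gt0//; last by lra.
  apply: le_trans (expR_ge1Dx _).
  rewrite ler_pdivrMr; lra.
- have t2 : 2 / n%:R <= s * v <= 2 by rewrite (ltW far).
  apply: le_trans (prod_cos_far n0 t2) _.
  rewrite mulNr expRN -[leRHS]invf_div lef_pV2 ?posrE ?expR_gt0 ?divr_gt0//; last by lra.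
  have n16 : 0 <= n%:R / 16 :> R by rewrite divr_ge0.
  (* The cubic term of the exponential is kept because s v <= 2 only yields v^2 <= 2 n^3/3. *)
  apply: le_trans (expR_ge1Dxn 2 n16).
  have -> : 3`! = 6%N by [].
  have : (s * v) ^+ 2 <= 2 ^+ 2 by rewrite ler_sqr ?nnegrE.
  have n3 : 1 <= n%:R ^+ 3 :> R by rewrite exprn_ege1.
  move/(ler_wpM2r (le_trans ler01 n3)); rewrite tn => h.
  rewrite ler_pdivrMr; lra.
Qed.

(** * Rescaling and the pointwise Gaussian limit *)

Definition freq (R : realType) (n : nat) : R :=
  Num.sqrt 6 * n%:R `^ (- (3 / 2)).

Lemma freq_gt0 (R : realType) n : (0 < n)%N -> 0 < freq R n.
Proof. by move=> n0; rewrite mulr_gt0// ?sqrtr_gt0// powR_gt0// ltr0n. Qed.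

(** The normalization that turns the main exponent t^2 n^3/6 into v^2 when t = s v. *)
Lemma freq_sqr (R : realType) n : (0 < n)%N -> freq R n ^+ 2 * n%:R ^+ 3 = 6.
Proof.
move=> n0; have n0' : n%:R != 0 :> R by rewrite pnatr_eq0 -lt0n.
rewrite exprMn sqr_sqrtr// -[_ `^ _ ^+ 2]powR_mulrn ?powR_ge0// -powRrM.
have -> : - (3 / 2) * 2%:R = - 3%:R :> R by lra.
by rewrite powR_invn// mulfVK// expf_neq0.
Qed.

(** The square of the left side is 6 v^2/n, so for fixed v the small-angle bounds eventually
    apply. *)
Lemma near_freq_le1 (R : realType) (v : R) : 0 <= v ->
  \forall n \near \oo, n%:R * (freq R n * v) <= 1.
Proof.
move=> v0; near=> n.
have n0 : (0 < n)%N by near: n; exists 1%N.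
have n0' : n%:R != 0 :> R by rewrite pnatr_eq0 -lt0n.
have sv0 : 0 <= freq R n * v by rewrite mulr_ge0// ltW// freq_gt0.
rewrite -ler_sqr ?nnegrE ?mulr_ge0// expr1n.
have -> : (n%:R * (freq R n * v)) ^+ 2 =
    (freq R n ^+ 2 * n%:R ^+ 3) * v ^+ 2 / n%:R by field.
rewrite freq_sqr// ler_pdivrMr ?ltr0n// mul1r.
by near: n; exact: nbhs_infty_ger.
Unshelve. all: by end_near. Qed.

Lemma cvg_prod_cos (R : realType) (v : R) : 0 <= v ->
  \prod_(1 <= k < n.+1) cos (k%:R * (freq R n * v)) @[n --> \oo] -->
  expR (- v ^+ 2).
Proof.
move=> v0.
have cinv : (n%:R^-1 : R) @[n --> \oo] --> (0 : R).
  by rewrite -(cvg_shiftS _); exact: cvg_harmonic.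
have cE (c : R) : expR (- v ^+ 2 + c * n%:R^-1) @[n --> \oo] --> expR (- v ^+ 2).
  apply: continuous_cvg; first exact: continuous_expR.
  rewrite -[X in _ --> X]addr0; apply: cvgD; first exact: cvg_cst.
  by rewrite -[X in _ --> X](mulr0 c); apply: cvgMl_tmp.
(* Since s^2 = 6/n^3, the errors t^2 n^2/3 and t^4 n^5/2 become 2 v^2/n and 18 v^4/n. *)
apply: (squeeze_cvgr _ (cE (- (2 * v ^+ 2 + 18 * v ^+ 4))) (cE (18 * v ^+ 4))).
near=> n.
have n0 : (0 < n)%N by near: n; exists 1%N.
have n0' : n%:R != 0 :> R by rewrite pnatr_eq0 -lt0n.
have s2 : freq R n ^+ 2 = 6 / n%:R ^+ 3.
  by rewrite -(freq_sqr R n0) mulfK// expf_neq0.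
have sv0 : 0 <= freq R n * v by rewrite mulr_ge0// ltW// freq_gt0.
have nsv1 : n%:R * (freq R n * v) <= 1.
  by near: n; exact: near_freq_le1.
have := prod_cos_bounds sv0 nsv1.
have -> : (freq R n * v) ^+ 2 * n%:R ^+ 3 / 6 = v ^+ 2.
  by rewrite exprMn s2; field.
have -> : (freq R n * v) ^+ 2 * n%:R ^+ 2 / 3 = 2 * v ^+ 2 * n%:R^-1.
  by rewrite exprMn s2; field.
have -> : (freq R n * v) ^+ 4 * n%:R ^+ 5 / 2 = 18 * v ^+ 4 * n%:R^-1.
  by rewrite exprMn -[4%N]/(2 * 2)%N [freq R n ^+ _]exprM s2; field.
by rewrite -mulrDl mulNr.
Unshelve. all: by end_near. Qed.

(** * Expansion of the cosine product over the coefficients *)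

Definition pairing (R : realType) (p : {poly int}) (c : nat -> R) : R :=
  \sum_(j < size p) (p`_j)%:~R * c j.

Lemma pairing_widen (R : realType) (p : {poly int}) (c : nat -> R) m :
  (size p <= m)%N -> pairing p c = \sum_(j < m) (p`_j)%:~R * c j.
Proof.
move=> pm; rewrite /pairing (big_ord_widen m (fun j => (p`_j)%:~R * c j))//.
rewrite big_mkcond/=; apply: eq_bigr => j _.
by case: ltnP => // jp; rewrite nth_default// mul0r.
Qed.

(** Transposes multiplication by 1 + X^b under the functional sending X^j to c j, so that the
    expansion below runs by induction on real cosines, without complex exponentials. *)
Lemma pairing_mul1Xn (R : realType) (p : {poly int}) (c : nat -> R) b :
  pairing (p * (1 + 'X^b)) c = pairing p (fun j => c j + c (j + b)%N).
Proof.
have sz : (size (p * (1 + 'X^b))%R <= size p + b)%N.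
  rewrite mulrDr mulr1 (leq_trans (size_polyD _ _))// geq_max leq_addr/=.
  have [->|p0] := eqVneq p 0; first by rewrite mul0r size_poly0.
  by rewrite size_mulXn// addnC.
rewrite (pairing_widen _ sz).
under eq_bigr do rewrite mulrDr mulr1 coefD coefMXn intrD mulrDl.
rewrite big_split/= -pairing_widen ?leq_addr// addnC big_split_ord/=.
rewrite [X in _ + (X + _)]big1 ?add0r.
  rewrite /pairing -big_split; apply: eq_bigr => j _ /=.
  by rewrite ltnNge leq_addr/= addKn -mulrDr addnC.
by move=> j _; rewrite ltn_ord mul0r.
Qed.

(** Induction by 2 cos a cos b = cos (a - b) + cos (a + b): the centre n(n+1)/2 grows by n + 1, so
    keeping j gives a - b and moving to j + n + 1 gives a + b. *)
Lemma prod_cos_pairing (R : realType) n (t : R) :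
  2 ^+ n * \prod_(1 <= k < n.+1) cos (k%:R * t) =
  pairing (prod_1Xk n) (fun j => cos ((j.*2%:R - (n * n.+1)%:R / 2) * t)).
Proof.
elim: n => [|n IH].
  rewrite /prod_1Xk !big_geq// /pairing size_poly1 big_ord1 coef1 /=.
  by rewrite mul0n mul0r subrr mul0r cos0 expr0.
rewrite big_nat_recr//= exprSr mulrACA IH.
have -> : prod_1Xk n.+1 = prod_1Xk n * (1 + 'X^(n.+1)).
  by rewrite /prod_1Xk big_nat_recr.
rewrite pairing_mul1Xn /pairing mulr_suml; apply: eq_bigr => j _.
rewrite -mulrA; congr (_ * _).
set a := (_ - _) * t; set b := _.+1%:R * t.
have -> : (j.*2%:R - (n.+1 * n.+2)%:R / 2) * t = a - b.
  by rewrite /a /b !natrM -[n.+2%:R]natr1 -[n.+1%:R]natr1; lra.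
have -> : ((j + n.+1).*2%:R - (n.+1 * n.+2)%:R / 2) * t = a + b.
  by rewrite /a /b -!muln2 !natrM !natrD -[n.+2%:R]natr1 -[n.+1%:R]natr1; lra.
rewrite cosB cosD; lra.
Qed.

Lemma continuous_prod_cos (R : realType) n (s : R) :
  continuous (fun v : R => \prod_(1 <= k < n.+1) cos (k%:R * (s * v))).
Proof.
elim: n => [|n IH] v.
  by under eq_fun do rewrite big_geq//; exact: cvg_cst.
under eq_fun do rewrite big_nat_recr//=.
apply: cvgM; first exact: IH.
apply: continuous_comp; last exact: continuous_cos.
by apply: cvgMl_tmp; apply: cvgMl_tmp; exact: cvg_id.
Qed.

(** * Extraction of the middle coefficient by integration *)

Lemma admissible_mul4 n : admissible n -> (4 * ((n * n.+1) %/ 4) = n * n.+1)%N.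
Proof.
move=> [_ n4]; rewrite mulnC divnK//.
have [k [->|->]] : exists k, n = (4 * k)%N \/ n = (4 * k + 3)%N.
  by exists (n %/ 4)%N; have := divn_eq n 4; case: n4; lia.
- by rewrite -mulnA dvdn_mulr.
- have -> : ((4 * k + 3) * (4 * k + 3).+1 = 4 * ((4 * k + 3) * k.+1))%N by nia.
  by rewrite dvdn_mulr.
Qed.

Lemma sin_natpi (R : realType) n : sin (n%:R * pi) = 0 :> R.
Proof.
elim: n => [|n IH]; first by rewrite mul0r sin0.
by rewrite -natr1 mulrDl mul1r sinDpi IH oppr0.
Qed.

Lemma integral_prod_cos (R : realType) n (s : R) : admissible n -> 0 < s ->
  (\int[lebesgue_measure]_(v in `[0%R, (pi / 2 / s)%R])
    (\prod_(1 <= k < n.+1) cos (k%:R * (s * v)))%:E =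
  ((mid_coef n)%:~R / 2 ^+ n * (pi / 2 / s))%:E)%E.
Proof.
move=> n4 s0; set T := pi / 2 / s.
pose f (v : R) := \prod_(1 <= k < n.+1) cos (k%:R * (s * v)).
set m := ((n * n.+1) %/ 4)%N.
pose w (j : nat) : R := 2 * (j%:R - m%:R).
(* Primitive of cos (w j * s * v); the zero frequency j = m is separate. *)
pose h (j : nat) (v : R) : R :=
  if j == m then v else sin (w j * s * v) / (w j * s).
(* Admissibility enters here: every frequency becomes 2 (j - m). *)
have nm : (n * n.+1)%:R / 2 = 2 * m%:R :> R.
  by rewrite -(admissible_mul4 n4) -/m natrM; lra.
have w0 j : j != m -> w j * s != 0.
  by move=> jm; rewrite /w !mulf_eq0 !negb_or subr_eq0 eqr_nat jm pnatr_eq0 (gt_eqF s0).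
(* Large enough for m to be an index of the sum without computing the degree. *)
pose B := (size (prod_1Xk n) + m.+1)%N.
pose F (v : R) := (2 ^+ n)^-1 * \sum_(j < B) ((prod_1Xk n)`_j)%:~R * h j v.
have dh (j : nat) (v : R) : is_derive v 1 (h j) (cos (w j * s * v)).
  rewrite /h; have [->|/w0 jm] := eqVneq j m.
    by rewrite /w subrr mulr0 !mul0r cos0; exact: is_derive_id.
  by apply: is_derive_eq; rewrite /GRing.scale/= !mulr0 add0r mulr1 [X in _ * X]mulrC mulKf.
have dF (v : R) : is_derive v 1 F (f v).
  have -> : f v = (2 ^+ n)^-1 * \sum_(j < B) ((prod_1Xk n)`_j)%:~R *
      cos (w j * s * v).
    have := prod_cos_pairing n (s * v).
    rewrite (@pairing_widen _ _ _ B) ?leq_addr// => E.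
    apply: (@mulfI _ (2 ^+ n)); first by rewrite expf_neq0.
    rewrite /f E mulVKf ?expf_neq0//; apply: eq_bigr => j _.
    congr (_ * cos _); rewrite nm /w -muln2 natrM; ring.
  have -> : F = (2 ^+ n)^-1 *: \sum_(j < B) (((prod_1Xk n)`_j)%:~R *: h j).
    by apply/funext => x; rewrite /F fctE fct_sumE.
  apply: is_deriveZ; apply: is_derive_sum => j; exact: is_deriveZ.
have cF (v : R) : {for v, continuous F}.
  by apply/differentiable_continuous/derivable1_diffP/ex_derive.
have T0 : 0 < T by rewrite !divr_gt0// pi_gt0.
rewrite (@continuous_FTC2 R f F)//.
- have hT j : h j T = if j == m then T else 0.
    rewrite /h; case: eqVneq => // jm.
    (* At the endpoint T the angle is an integer multiple of pi, so only j = m survives. *)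
    have -> : w j * s * T = (j%:R - m%:R) * pi by rewrite /T /w; field; rewrite gt_eqF.
    by rewrite mulrBl sinB !sin_natpi mul0r mulr0 subrr mul0r.
  have h0 j : h j 0 = 0 by rewrite /h; case: eqP => // _; rewrite mulr0 sin0 mul0r.
  have -> : F 0 = 0 by rewrite /F big1 ?mulr0// => j _; rewrite h0 mulr0.
  have mB : (m < B)%N by rewrite /B addnS ltnS leq_addl.
  rewrite sube0; congr (_%:E); rewrite /F (bigD1 (Ordinal mB))//= hT eqxx.
  rewrite big1 ?addr0; first by rewrite /mid_coef -/m; ring.
  move=> j jm; rewrite hT ifN ?mulr0//.
- by apply: continuous_subspaceT; exact: continuous_prod_cos.
- split.
  + by move=> x _; exact: ex_derive.
  + by apply: cvg_at_right_filter; exact: cF.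
  + by apply: cvg_at_left_filter; exact: cF.
- by move=> v _; rewrite derive1E; apply: derive_val.
Qed.

(** * Dominated convergence to the Gaussian integral *)

Lemma integrable_oneDsqrV (R : realType) :
  (@lebesgue_measure R).-integrable `[0%R, +oo[ (fun v => ((1 + v ^+ 2)^-1)%:E).
Proof.
have mf : measurable_fun setT (fun v : R => (1 + v ^+ 2)^-1).
  by apply: continuous_measurable_fun; exact: continuous_oneDsqrV.
apply/integrableP; split; first exact/measurable_EFinP/measurable_funTS.
apply: (@le_lt_trans _ _ (\int[lebesgue_measure]_(v in `[0%R, +oo[)
    ((1 + v ^+ 2)^-1)%:E)%E).
  rewrite le_eqVlt; apply/orP; left; apply/eqP; apply: eq_integral => v _.
  by rewrite gee0_abs// lee_fin invr_ge0 addr_ge0// sqr_ge0.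
rewrite (@ge0_continuous_FTC2y R _ atan 0 (pi / 2)) ?ltry//.
- by move=> x _; rewrite invr_ge0 addr_ge0// sqr_ge0.
- apply: continuous_subspaceT; exact: continuous_oneDsqrV.
- exact: cvgy_atan.
- by apply: cvg_at_right_filter; exact: continuous_atan.
- by move=> x _; rewrite derive1_atan.
Qed.

Lemma cvg_integral_prod_cos (R : realType) :
  (\int[lebesgue_measure]_(v in `[0%R, (pi / 2 / freq R n)%R])
    (\prod_(1 <= k < n.+1) cos (k%:R * (freq R n * v)))%:E @[n --> \oo] -->
  (Num.sqrt pi / 2)%:E)%E.
Proof.
(* The shift makes every term have n >= 1, since the domination must hold for all indices and [freq]
   is positive only there. *)
rewrite -integral0y_gauss -(cvg_shiftS (fun n => _)).
pose h n v : R := \prod_(1 <= k < n.+2) cos (k%:R * (freq R n.+1 * v)).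
pose I n : set R := `[0%R, pi / 2 / freq R n.+1]%classic.
have mh n : measurable_fun setT (h n).
  by apply: continuous_measurable_fun; exact: continuous_prod_cos.
(* Extension by zero replaces the growing intervals by the fixed half-line. *)
have -> : (fun n => \int[lebesgue_measure]_(v in I n) (h n v)%:E)%E =
    (fun n => \int[lebesgue_measure]_(v in `[0%R, +oo[)
      (((EFin \o h n) \_ (I n)) v))%E.
  apply/funext => n; rewrite -integral_mkcondr setIidr//.
  exact: subset_itvl.
apply: (@dominated_cvg _ _ R lebesgue_measure _ _ _ _
  (fun v => (10 ^+ 5 / (1 + v ^+ 2))%:E)) => //.
- move=> n; apply/measurable_restrict => //; first exact: measurable_itv.
  by apply/measurable_EFinP; apply: measurable_funTS; exact: mh.
- move=> v; rewrite /= in_itv/= andbT => v0.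
  have hv : (h n v)%:E @[n --> \oo] --> (gauss_fun v)%:E.
    apply/fine_cvgP; split; first exact: nearW.
    by have := cvg_prod_cos v0; rewrite -(cvg_shiftS (fun n => _)).
  apply: cvg_trans hv; apply: near_eq_cvg; near=> n.
  rewrite patchE ifT//= inE /I /= in_itv/= v0 /=.
  (* A fixed v eventually lies in [I n], as s v <= n s v <= 1 <= pi/2. *)
  rewrite ler_pdivlMr ?freq_gt0// mulrC (le_trans _ (pihalf_ge1 R))//.
  have : n.+1%:R * (freq R n.+1 * v) <= 1.
    by near: n; have [N _ HN] := near_freq_le1 v0; exists N => // m /= /leqW/HN.
  by apply: le_trans; rewrite ler_peMl ?ler1n// mulr_ge0// ltW// freq_gt0.
- have : (@lebesgue_measure R).-integrable `[0%R, +oo[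
      (fun v => (10 ^+ 5)%:E * ((1 + v ^+ 2)^-1)%:E)%E.
    by apply: integrableZl => //; exact: integrable_oneDsqrV.
  exact.
- move=> n v; rewrite /= in_itv/= andbT => v0.
  rewrite patchE; case: ifPn => [|_]; last first.
    by rewrite abse0 lee_fin divr_ge0// addr_ge0// sqr_ge0.
  rewrite inE /I /= in_itv/= => /andP[_ vI].
  have s0 := freq_gt0 R (ltn0Sn n).
  rewrite lee_fin prod_cos_dominated ?freq_sqr// ?(ltW s0)//.
  rewrite mulrC -ler_pdivlMr// (le_trans vI)//.
  by rewrite ler_wpM2r ?invr_ge0 ?(ltW s0)// ltW// pihalf_lt2.
Unshelve. all: by end_near. Qed.

Theorem theorem4 (R : realType) :
  ((mid_coef n)%:~R
     / (Num.sqrt (6 / pi) * 2 ^+ n * n%:R `^ (- (3 / 2))))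
    @[n --> within [set n | admissible n] \oo] --> (1 : R).
Proof.
pose J n := (\int[lebesgue_measure]_(v in `[0%R, (pi / 2 / freq R n)%R])
    (\prod_(1 <= k < n.+1) cos (k%:R * (freq R n * v)))%:E)%E.
have pi0 : 0 < pi :> R := pi_gt0 R.
have sp0 : 0 < Num.sqrt pi :> R by rewrite sqrtr_gt0.
have cJ : fine (J n) * (2 / Num.sqrt pi) @[n --> \oo] --> (1 : R).
  rewrite [X in _ --> X](_ : 1 = Num.sqrt pi / 2 * (2 / Num.sqrt pi)); last first.
    by field; rewrite gt_eqF.
  apply: cvgMr_tmp; apply: (@fine_cvg _ _ _ _ J).
  exact: cvg_integral_prod_cos.
have : fine (J n) * (2 / Num.sqrt pi) @[n --> within [set n | admissible n] \oo]
    --> (1 : R).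
  exact: cvg_within_filter.
apply: cvg_trans; apply: near_eq_cvg; near=> n.
have n4 : admissible n by near: n; exact: withinT.
have n0 : (0 < n)%N by case: n4.
(* For admissible n the two sides agree exactly: (pi / (2 s)) (2 / sqrt pi) = sqrt pi / s, and s /
   sqrt pi = sqrt (6/pi) n^(-3/2). *)
rewrite /J integral_prod_cos ?freq_gt0//=.
rewrite sqrtrM// sqrtrV ?pi_ge0// /freq.
have s6 : Num.sqrt 6 != 0 :> R by rewrite gt_eqF// sqrtr_gt0.
have nz : n%:R `^ (- (3 / 2)) != 0 :> R by rewrite gt_eqF// powR_gt0// ltr0n.
have spi : pi = Num.sqrt pi ^+ 2 :> R by rewrite sqr_sqrtr ?pi_ge0.
set q := Num.sqrt pi in spi sp0 *; rewrite spi.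
by field; rewrite nz s6 expf_neq0 ?gt_eqF.
Unshelve. all: by end_near. Qed.
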